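(* (Triple spread formula) Let $\mathbb{F}$ be a field of characteristic not $2$ and let $B$ be an invertible symmetric $3\times 3$ matrix over $\mathbb{F}$. Let $\overline{v_1v_2v_3}$ be a vector triangle in $\mathbb{V}^3=\mathbb{F}^3$ whose $B$-spreads $s_1,s_2,s_3$ are defined (i.e. $v_1,v_2,v_3$ are all non-null). Then $$(s_1+s_2+s_3)^2=2\left(s_1^2+s_2^2+s_3^2\right)+4s_1s_2s_3.$$
   Context: $\mathbb{V}^3$ is the space of row vectors over $\mathbb{F}$. The $B$-scalar product is $v\cdot_B w=vBw^T$, the $B$-quadrance is $Q_B(v)=v\cdot_B v$, and $v$ is null if $Q_B(v)=0$. A vector triangle $\overline{v_1v_2v_3}$ is an unordered collection of three vectors with $v_1+v_2+v_3=\mathbf{0}$. The $B$-spread of non-null vectors $v,w$ is $s_B(v,w)=1-\dfrac{(v\cdot_B w)^2}{Q_B(v)Q_B(w)}$ (undefined if $v$ or $w$ is null), and the $B$-spreads of the triangle are $s_1=s_B(v_2,v_3)$, $s_2=s_B(v_1,v_3)$, $s_3=s_B(v_1,v_2)$. *)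

(* Defs.v *)
From mathcomp Require Import all_boot all_order all_algebra.

Set Implicit Arguments.
Unset Strict Implicit.
Unset Printing Implicit Defensive.

Import GRing.Theory.
Local Open Scope ring_scope.

Definition dotB (F : fieldType) (B : 'M[F]_3) (v w : 'rV[F]_3) : F :=
  (v *m B *m w^T) 0 0.

Definition quadrance (F : fieldType) (B : 'M[F]_3) (v : 'rV[F]_3) : F :=
  dotB B v v.

Definition null (F : fieldType) (B : 'M[F]_3) (v : 'rV[F]_3) : Prop :=
  quadrance B v = 0.

(* The collection is unordered; v1, v2, v3 is an arbitrary labelling of it,
   and repetitions are allowed. *)
Definition vector_triangle (F : fieldType) (v1 v2 v3 : 'rV[F]_3) : Prop :=
  v1 + v2 + v3 = 0.

(* Meaningful only when v and w are both non-null: the value taken otherwise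
   is an artefact of the convention 0^-1 = 0. *)
Definition spread (F : fieldType) (B : 'M[F]_3) (v w : 'rV[F]_3) : F :=
  1 - dotB B v w ^+ 2 / (quadrance B v * quadrance B w).

(* Main.v *)
Require Import Defs.
From mathcomp Require Import all_boot all_order all_algebra.
From mathcomp Require Import ring.

Set Implicit Arguments.
Unset Strict Implicit.
Unset Printing Implicit Defensive.

Import GRing.Theory.
Local Open Scope ring_scope.

(** Write [Q1], [Q2], [Q3] for the quadrances of the three sides. Since
    [v3 = - v1 - v2], passing from one pair of sides to another is a
    linear substitution of determinant [1] or [-1], so the Gram determinant
    [D = Q1 * Q2 - (v1 . v2) ^+ 2] is the same for all three pairs
    ([gram_tri]). As a spread is the Gram determinant of its two vectors
    divided by the product of their quadrances ([spread_gram]), each spread is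
    proportional to the opposite quadrance, with one common factor:
    [s_i = k * Q_i] for [k = D / (Q1 * Q2 * Q3)]; this is the rational form of
    the sine law.

    On the other hand [Q3 = Q1 + Q2 + 2 (v1 . v2)], which yields Archimedes'
    formula [(Q1 + Q2 + Q3) ^+ 2 - 2 (Q1 ^+ 2 + Q2 ^+ 2 + Q3 ^+ 2) = 4 D]
    ([archimedes]), the rational form of Heron's formula. Multiplying it by
    [k ^+ 2] turns the quadrances on the left into spreads, and
    [k ^+ 2 * D = k ^+ 3 * Q1 * Q2 * Q3 = s1 * s2 * s3]. *)

Section Triangle.

Variables (F : fieldType) (B : 'M[F]_3).

Implicit Types u v w : 'rV[F]_3.

Lemma dotBDr u v w : dotB B u (v + w) = dotB B u v + dotB B u w.
Proof. by rewrite /dotB linearD mulmxDr mxE. Qed.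

Lemma dotBNr u v : dotB B u (- v) = - dotB B u v.
Proof. by rewrite /dotB linearN mulmxN mxE. Qed.

(** A [1 x 1] matrix is its own transpose. *)
Lemma dotBC v w : B^T = B -> dotB B v w = dotB B w v.
Proof.
move=> B_sym; rewrite /dotB -[in LHS](trmxK (v *m B *m w^T)) [LHS]mxE.
by rewrite !trmx_mul trmxK B_sym mulmxA.
Qed.

Definition gram v w : F := quadrance B v * quadrance B w - dotB B v w ^+ 2.

Lemma gramC v w : B^T = B -> gram v w = gram w v.
Proof. by move=> B_sym; rewrite /gram (dotBC v w B_sym) mulrC. Qed.

Lemma spread_gram v w : quadrance B v != 0 -> quadrance B w != 0 ->
  spread B v w = gram v w / (quadrance B v * quadrance B w).
Proof.
by move=> v_nn w_nn; rewrite /spread /gram mulrBl divff // mulf_neq0.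
Qed.

Lemma tri_opp v1 v2 v3 : vector_triangle v1 v2 v3 -> v3 = - (v1 + v2).
Proof. by move=> /eqP; rewrite addrC addr_eq0 => /eqP. Qed.

Lemma triC v1 v2 v3 : vector_triangle v1 v2 v3 -> vector_triangle v2 v1 v3.
Proof. by rewrite /vector_triangle (addrC v2). Qed.

(** This is the law of cosines; its plus sign comes from orienting the sides
    head to tail. *)
Lemma quadrance_tri v1 v2 v3 : B^T = B -> vector_triangle v1 v2 v3 ->
  quadrance B v3 = quadrance B v1 + quadrance B v2 + 2%:R * dotB B v1 v2.
Proof.
move=> B_sym /tri_opp ->; rewrite /quadrance dotBNr dotBC // dotBNr.
rewrite dotBDr !(dotBC (v1 + v2)) // !dotBDr (dotBC v2 v1) //; ring.
Qed.

(** Replacing [v1] by [v3 = - v1 - v2] is, up to sign, a shear along [v2]. *)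
Lemma gram_tri v1 v2 v3 : B^T = B -> vector_triangle v1 v2 v3 ->
  gram v2 v3 = gram v1 v2.
Proof.
move=> B_sym tri; rewrite /gram (quadrance_tri B_sym tri) (tri_opp tri).
by rewrite dotBNr dotBDr (dotBC v2 v1) // -/(quadrance B v2); ring.
Qed.

(** By the law of cosines, the difference is [4 Q1 Q2 - (Q3 - Q1 - Q2) ^+ 2],
    where [Q3 - Q1 - Q2] is twice the scalar product. *)
Lemma archimedes v1 v2 v3 : B^T = B -> vector_triangle v1 v2 v3 ->
  (quadrance B v1 + quadrance B v2 + quadrance B v3) ^+ 2
    - 2%:R * (quadrance B v1 ^+ 2 + quadrance B v2 ^+ 2 + quadrance B v3 ^+ 2)
  = 4%:R * gram v1 v2.
Proof. by move=> B_sym tri; rewrite /gram (quadrance_tri B_sym tri); ring. Qed.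

End Triangle.

Theorem theorem22 (F : fieldType) (char_neq2 : 2%N \notin [pchar F])
    (B : 'M[F]_3) (B_inv : B \in unitmx) (B_sym : B^T = B)
    (v1 v2 v3 : 'rV[F]_3) (tri : vector_triangle v1 v2 v3)
    (nn1 : ~ null B v1) (nn2 : ~ null B v2) (nn3 : ~ null B v3) :
  let s1 := spread B v2 v3 in
  let s2 := spread B v1 v3 in
  let s3 := spread B v1 v2 in
  (s1 + s2 + s3) ^+ 2 =
    2%:R * (s1 ^+ 2 + s2 ^+ 2 + s3 ^+ 2) + 4%:R * s1 * s2 * s3.
Proof.
move=> s1 s2 s3.
move/eqP: nn1 => nn1; move/eqP: nn2 => nn2; move/eqP: nn3 => nn3.
have heron := archimedes B_sym tri.
have s1E := spread_gram nn2 nn3; rewrite (gram_tri B_sym tri) in s1E.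
have s2E := spread_gram nn1 nn3.
rewrite (gram_tri B_sym (triC tri)) (gramC _ _ B_sym) in s2E.
have s3E := spread_gram nn1 nn2.
rewrite /s1 /s2 /s3 {s1 s2 s3}.
move: (quadrance B v1) (quadrance B v2) (quadrance B v3) (gram B v1 v2)
  nn1 nn2 nn3 heron s1E s2E s3E => Q1 Q2 Q3 D nn1 nn2 nn3 heron s1E s2E s3E.
pose k := D / (Q1 * Q2 * Q3).
have {}s1E : spread B v2 v3 = k * Q1
  by rewrite s1E /k; field; rewrite ?nn1 ?nn2 ?nn3.
have {}s2E : spread B v1 v3 = k * Q2
  by rewrite s2E /k; field; rewrite ?nn1 ?nn2 ?nn3.
have {}s3E : spread B v1 v2 = k * Q3
  by rewrite s3E /k; field; rewrite ?nn1 ?nn2 ?nn3.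
have kQ : k * (Q1 * Q2 * Q3) = D by rewrite divfK // !mulf_neq0.
rewrite s1E s2E s3E [RHS]addrC; apply/eqP; rewrite -subr_eq; apply/eqP.
transitivity (k ^+ 2 * ((Q1 + Q2 + Q3) ^+ 2
                        - 2%:R * (Q1 ^+ 2 + Q2 ^+ 2 + Q3 ^+ 2))); first by ring.
by rewrite heron -kQ; ring.
Qed.
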